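(* Let $m\geq 1$ and $n\geq 0$. For any $u\in\mathbb{N}^n$, let $\varphi_1(u),\varphi_2(u)$ be the words of length $n$ whose first letter (if $n \geq 1$) is $0$ and such that $\varphi_1(u)_i = u_i+1$ and $\varphi_2(u)_i = u_i-1$ for $2\leq i\leq n$. Then: (a) $\varphi_1$ is a poset isomorphism from $\mathsf{Av}_{\mathbf{m}-\mathbf{1}}(n)$ to $\mathcal{I}(\mathsf{Av}_{\mathbf{m}})(n)$; (b) $\varphi_2$ is a poset embedding from $\mathcal{I}(\mathsf{Av}_{\mathbf{m}})(n)$ to $\mathcal{O}(\mathsf{Av}_{\mathbf{m}})(n)$; (c) $\varphi_1$ is a poset isomorphism from $\mathcal{O}(\mathsf{Av}_{\mathbf{m}})(n)$ to $\mathcal{B}(\mathsf{Av}_{\mathbf{m}+\mathbf{1}})(n)$.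
   Context: For an integer $m\geq 0$, $\mathbf{m}$ is the map on positive integers $\mathbf{m}(i) = (i-1)m$; $\mathbf{m}-\mathbf{1}$ and $\mathbf{m}+\mathbf{1}$ are the maps $i\mapsto (i-1)(m-1)$ and $i\mapsto(i-1)(m+1)$. For such a map $\delta$, a $\delta$-cliff of size $n$ is a word $u=u_1\cdots u_n$ of nonnegative integers with $u_i\leq\delta(i)$ for all $i$. $\mathsf{Av}_\delta(n)$ is the set of $\delta$-cliffs $u$ of size $n$ ($\delta$-avalanches) such that $u_1+\cdots+u_k\leq\delta(k)$ for all $1\leq k\leq n$. All sets of words of length $n$ are ordered componentwise: $u\preccurlyeq v$ iff $u_i\leq v_i$ for all $i$. Let $\dim_n(\delta) := \#\{i\in\{1,\dots,n\}:\delta(i)\neq 0\}$. In the poset $\mathsf{Av}_\delta(n)$, the set $\mathcal{I}(\mathsf{Av}_\delta)(n)$ of input-wings consists of the elements covering exactly $\dim_n(\delta)$ elements of $\mathsf{Av}_\delta(n)$; the set $\mathcal{O}(\mathsf{Av}_\delta)(n)$ of output-wings consists of the elements covered by exactly $\dim_n(\delta)$ elements of $\mathsf{Av}_\delta(n)$; and the set of butterflies is $\mathcal{B}(\mathsf{Av}_\delta)(n) = \mathcal{I}(\mathsf{Av}_\delta)(n)\cap\mathcal{O}(\mathsf{Av}_\delta)(n)$. These are posets for the componentwise order. A map $\phi$ between posets is a poset embedding if $x\preccurlyeq y\iff\phi(x)\preccurlyeq\phi(y)$; it is a poset isomorphism if it is moreover bijective. *)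

(* Defs.v *)
From HB Require Import structures.
From mathcomp Require Import all_boot all_order all_algebra.
From mathcomp Require Import boolp classical_sets functions cardinality.

Set Implicit Arguments.
Unset Strict Implicit.
Unset Printing Implicit Defensive.

Import Order.TTheory GRing.Theory Num.Theory.

Local Open Scope classical_set_scope.
Local Open Scope card_scope.
Local Open Scope ring_scope.

Section Posets.
Context {d d' : Order.disp_t} {T : porderType d} {T' : porderType d'}.

(* Covering relation of the subposet A, read: v covers u in A. *)
Definition covers (A : set T) (v u : T) : Prop :=
  [/\ A u, A v, (u < v)%O & forall w, A w -> ~ ((u < w)%O /\ (w < v)%O)].

Definition poset_embedding (A : set T) (B : set T') (f : T -> T') : Prop :=
  set_fun A B f /\
  (forall x y, A x -> A y -> ((x <= y)%O <-> (f x <= f y)%O)).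

Definition poset_isomorphism (A : set T) (B : set T') (f : T -> T') : Prop :=
  poset_embedding A B f /\ set_bij A B f.

End Posets.

(* Words of length n under the componentwise order. Letters are integers, so
   that decrementing a letter is never truncated; nonnegativity is imposed by
   [cliff]. *)
Definition word (n : nat) := n.-tuple int.

HB.instance Definition _ (n : nat) :=
  Order.POrder.copy (word n) (n.-tupleprod int).

Lemma le_wordE (n : nat) (u v : word n) :
  (u <= v)%O = [forall i, tnth u i <= tnth v i].
Proof. exact: leEtprod. Qed.

(* Range maps are defined on positive integers: the letter of index i : 'I_n
   is the (i+1)-st one and is bounded by [delta i.+1]; [delta 0] is unused. *)
Definition mmap (m : nat) (i : nat) : nat := ((i - 1) * m)%N.

Definition cliff (delta : nat -> nat) (n : nat) : set (word n) :=
  [set u | forall i : 'I_n, 0 <= tnth u i /\ tnth u i <= (delta i.+1)%:Z].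

Definition avalanche (delta : nat -> nat) (n : nat) : set (word n) :=
  [set u | cliff delta u /\
     forall k : nat, (1 <= k <= n)%N ->
       \sum_(i < n | (i < k)%N) tnth u i <= (delta k)%:Z].

Definition dim_cliff (delta : nat -> nat) (n : nat) : nat :=
  #|[pred i : 'I_n | delta i.+1 != 0%N]|.

Definition input_wings (delta : nat -> nat) (n : nat) : set (word n) :=
  [set u | avalanche delta u /\
     [set v | covers (@avalanche delta n) u v] #= `I_(dim_cliff delta n)].

Definition output_wings (delta : nat -> nat) (n : nat) : set (word n) :=
  [set u | avalanche delta u /\
     [set v | covers (@avalanche delta n) v u] #= `I_(dim_cliff delta n)].

Definition butterflies (delta : nat -> nat) (n : nat) : set (word n) :=
  input_wings delta (n := n) `&` output_wings delta (n := n).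

Definition phi1 (n : nat) (u : word n) : word n :=
  [tuple (if i == 0%N :> nat then 0 else tnth u i + 1) | i < n].

Definition phi2 (n : nat) (u : word n) : word n :=
  [tuple (if i == 0%N :> nat then 0 else tnth u i - 1) | i < n].

Arguments cliff : clear implicits.
Arguments avalanche : clear implicits.
Arguments input_wings : clear implicits.
Arguments output_wings : clear implicits.
Arguments butterflies : clear implicits.

(* Main.v *)
Require Import Defs.
From mathcomp Require Import all_boot all_order all_algebra.
From mathcomp Require Import boolp classical_sets functions cardinality.
From mathcomp Require Import zify.

(** For an order-convex set of integer words, one element covers another exactly
    when the two differ by 1 in a single letter ([covers_convex]). Avalanches
    form such a set, so the number of elements covered by, or covering, an
    avalanche [u] is the number of positions at which [u] can be decremented,
    or incremented, within the avalanches. Such positions [i] satisfy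
    [delta i.+1 != 0], whence at most [dim_cliff delta n] of them, and [u] is a
    wing exactly when every position of this kind can be moved
    ([input_wingsP], [output_wingsP]).

    Write [psum u k] for the sum of the letters up to position [k], counting
    positions from 0. When [delta = mmap m] and [m >= 1], among nonnegative
    words with first letter 0,
    - avalanches are defined by [psum u k <= k * m];
    - input-wings by the further condition that every letter but the first is
      positive, as decrementing only threatens nonnegativity;
    - output-wings by [psum u k < k * m] for [k != 0], as incrementing only
      threatens the bounds on partial sums.
    Adding [c] to every letter but the first adds [c * k] to [psum u k], so a
    bound of slope [m] becomes one of slope [m + c], strict if it was strict.
    For [c = 1], nonnegative letters become positive: avalanches of slope
    [m - 1] go to input-wings, and output-wings of slope [m] to words that
    satisfy both wing conditions for [m + 1]. For [c = - 1], an input-wing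
    becomes a nonnegative word with bounds of slope [m - 1], and
    [k * (m - 1) < k * m] for [k != 0] makes it an output-wing. Addition
    of [c] to all letters but the first preserves and reflects the order, and is
    undone by addition of [- c]. *)

Set Implicit Arguments.
Unset Strict Implicit.
Unset Printing Implicit Defensive.

Import Order.TTheory GRing.Theory Num.Theory.

Local Open Scope classical_set_scope.
Local Open Scope card_scope.
Local Open Scope ring_scope.

(** * Covering relation in convex sets of words *)

Definition add_letter (n : nat) (u : word n) (i : 'I_n) (c : int) : word n :=
  [tuple tnth u j + c *+ (j == i) | j < n].

Lemma tnth_add_letter n (u : word n) i c j :
  tnth (add_letter u i c) j = tnth u j + c *+ (j == i).
Proof. by rewrite tnth_mktuple. Qed.

Lemma add_letterK n (i : 'I_n) (c : int) (u : word n) :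
  add_letter (add_letter u i c) i (- c) = u.
Proof.
by apply: eq_from_tnth => j; rewrite !tnth_add_letter; case: eqP; lia.
Qed.

Lemma add_letter_inj n (u : word n) c :
  c != 0 -> injective (fun i => add_letter u i c).
Proof.
move=> c0 i j /(congr1 (fun w : word n => tnth w i)).
by rewrite !tnth_add_letter eqxx; case: eqP => // _; lia.
Qed.

Lemma le_wordP n (u v : word n) :
  reflect (forall i, tnth u i <= tnth v i) (u <= v)%O.
Proof. by rewrite le_wordE; apply: forallP. Qed.

Lemma lt_word_letter n (u v : word n) :
  (u < v)%O -> exists i, tnth u i < tnth v i.
Proof.
move=> /lt_geF /negbT; rewrite le_wordE => /forallPn [i].
by rewrite -ltNge; exists i.
Qed.

Lemma lt_add_letter n (u : word n) i : (u < add_letter u i 1)%O.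
Proof.
rewrite lt_leAnge; apply/andP; split.
  by apply/le_wordP => j; rewrite tnth_add_letter; case: eqP; lia.
by apply/le_wordP => /(_ i); rewrite tnth_add_letter eqxx; lia.
Qed.

Definition order_convex (n : nat) (A : set (word n)) : Prop :=
  forall u v w, A u -> A w -> (u <= v)%O -> (v <= w)%O -> A v.

(** If [u < v], then [u] has a letter strictly below that of [v], and
    incrementing it gives a word of the interval from [u] to [v]; when [v]
    covers [u], convexity forces this word to be [v]. *)
Lemma covers_convex n (A : set (word n)) (u v : word n) :
  order_convex A ->
  covers A v u <-> [/\ A u, A v & exists i, v = add_letter u i 1].
Proof.
move=> convA; split=> [[Au Av ltuv nobtw]|[Au Av [i ev]]]; last subst v.
  split=> //; have [i lti] := lt_word_letter ltuv; exists i.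
  have leuv := ltW ltuv.
  (* The increment stays below v, so by convexity it lies in A. *)
  have lewv : (add_letter u i 1 <= v)%O.
    apply/le_wordP => j; move/le_wordP/(_ j): leuv.
    by rewrite tnth_add_letter; case: (j =P i) => [->|_]; lia.
  have Aw := convA _ _ _ Au Av (ltW (lt_add_letter u i)) lewv.
  apply/eqP; rewrite eq_sym; case: eqVneq => // neq.
  case: (nobtw _ Aw); split; first exact: lt_add_letter.
  by rewrite lt_neqAle neq.
split=> //; first exact: lt_add_letter.
move=> w _ [ltuw ltwv]; have [j ltj] := lt_word_letter ltuw.
have lewv := le_wordP _ _ (ltW ltwv).
(* The letters of u and of its increment agree outside i. *)
have eji : j = i.
  by move: (lewv j); rewrite tnth_add_letter; case: eqP => // _; lia.
have : (add_letter u i 1 <= w)%O.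
  apply/le_wordP => l; move/le_wordP/(_ l): (ltW ltuw).
  rewrite tnth_add_letter; case: (l =P i) => [->|_]; last lia.
  by move: ltj; rewrite eji; lia.
by rewrite (lt_geF ltwv).
Qed.

Lemma covered_byE n (A : set (word n)) (u : word n) : order_convex A -> A u ->
  [set v | covers A v u] =
  (fun i => add_letter u i 1) @` [set i | A (add_letter u i 1)].
Proof.
move=> convA Au; apply/seteqP; split=> v /=.
  by move=> /(covers_convex _ _ convA) [_ Av [i ev]]; exists i; rewrite -?ev.
by move=> [i Ai <-]; apply/covers_convex => //; split=> //; exists i.
Qed.

Lemma coversE n (A : set (word n)) (u : word n) : order_convex A -> A u ->
  [set v | covers A u v] =
  (fun i => add_letter u i (- 1)) @` [set i | A (add_letter u i (- 1))].
Proof.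
move=> convA Au; apply/seteqP; split=> v /=.
  move=> /(covers_convex _ _ convA) [Av _ [i eu]].
  by exists i; rewrite eu add_letterK.
move=> [i Ai <-]; apply/covers_convex => //; split=> //; exists i.
by rewrite -[in RHS](opprK 1) add_letterK.
Qed.

(** * Counting the movable positions *)

Lemma card_image_ord n (T : Type) (f : 'I_n -> T) (P : {pred 'I_n}) :
  injective f -> f @` [set i | i \in P] #= `I_#|P|.
Proof.
move=> injf.
have -> : f @` [set i | i \in P] = (f \o @enum_val _ P) @` setT.
  apply/seteqP; split=> x /=.
    by move=> [i Pi <-]; exists (enum_rank_in Pi i) => //=;
      rewrite enum_rankK_in.
  by move=> [k _ <-]; exists (enum_val k) => //; apply: enum_valP.
apply: card_eq_trans (card_esym card_II).
by apply: inj_card_eq => i j _ _ /injf /enum_val_inj.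
Qed.

(** Turns the requirement that a set of neighbours have the largest possible
    cardinality into the statement that every candidate position occurs. *)
Lemma card_image_ord_maxP n (T : Type) (f : 'I_n -> T) (X : set 'I_n)
    (D : {pred 'I_n}) :
  injective f -> (forall i, X i -> i \in D) ->
  f @` X #= `I_#|D| <-> (forall i, i \in D -> X i).
Proof.
move=> injf XD; pose P : {pred 'I_n} := [pred i | `[< X i >]].
have eX : X = [set i | i \in P].
  by apply/seteqP; split=> i /= /asboolP.
have PD : P \subset D by apply/fintype.subsetP => i /asboolP /XD.
have cardP := card_image_ord P injf; rewrite -eX in cardP.
have [_ eqPD] := subset_leqif_card PD.
split=> [cardD i Di|DX].
  have /card_eq_II/eqP : `I_#|P| #= `I_#|D|.
    exact: card_eq_trans (card_esym cardP) cardD.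
  by rewrite eqPD => /fintype.subsetP /(_ i Di) /asboolP.
suff <- : #|P| = #|D| by [].
by apply/eqP; rewrite eqPD; apply/fintype.subsetP => i Di; apply/asboolP/DX.
Qed.

(** * Avalanches and wings *)

Definition psum (n : nat) (u : word n) (k : nat) : int :=
  \sum_(i < n | (i <= k)%N) tnth u i.

Lemma psum_le n (u v : word n) k : (u <= v)%O -> psum u k <= psum v k.
Proof. by move=> /le_wordP uv; apply: ler_sum. Qed.

Lemma psum_add_letter n (u : word n) i c k :
  psum (add_letter u i c) k = psum u k + c *+ (i <= k)%N.
Proof.
rewrite /psum (eq_bigr _ (fun j _ => tnth_add_letter u i c j)) big_split /=.
congr (_ + _); rewrite big_mkcond /= (bigD1 i) //= eqxx big1 ?addr0.
  by case: (i <= k)%N.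
by move=> j /negbTE ->; case: ifP.
Qed.

Lemma letter_le_psum n (u : word n) (k : 'I_n) :
  (forall i, 0 <= tnth u i) -> tnth u k <= psum u k.
Proof. by move=> u0; rewrite /psum (bigD1 k) //= lerDl sumr_ge0. Qed.

(** The upper bounds on letters are implied by those on partial sums, a letter
    being at most the partial sum that it ends. *)
Lemma avalancheP delta n (u : word n) :
  avalanche delta n u <->
  (forall i, 0 <= tnth u i) /\
  (forall k : 'I_n, psum u k <= (delta k.+1)%:Z).
Proof.
split=> [[cu su]|[u0 su]].
  split=> [i|k]; first by case: (cu i).
  by apply: (su k.+1); rewrite ltn_ord.
split=> [i|[//|k] /= ltkn]; last exact: (su (Ordinal ltkn)).
by split=> //; apply: le_trans (su i); apply: letter_le_psum.
Qed.

Lemma avalanche_letter_le delta n (u : word n) i :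
  avalanche delta n u -> tnth u i <= (delta i.+1)%:Z.
Proof. by move=> [/(_ i) []]. Qed.

Lemma avalanche_letter_ge0 delta n (u : word n) i :
  avalanche delta n u -> 0 <= tnth u i.
Proof. by move=> [/(_ i) []]. Qed.

Lemma avalanche_convex delta n : order_convex (avalanche delta n).
Proof.
move=> u v w /avalancheP [u0 _] /avalancheP [_ sw] uv vw.
apply/avalancheP; split=> [i|k].
  by apply: le_trans (u0 i) _; apply/le_wordP.
by apply: le_trans (sw k); apply: psum_le.
Qed.

(** Decrementing a letter never breaks a bound on partial sums, so only the sign
    of that letter matters; and a positive letter forces [delta i.+1 != 0], so
    that [dim_cliff delta n] is the largest possible number of covered
    elements. *)
Lemma input_wingsP delta n (u : word n) :
  input_wings delta n u <->
  avalanche delta n u /\ (forall i : 'I_n, delta i.+1 != 0%N -> 1 <= tnth u i).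
Proof.
have decP i : avalanche delta n u ->
    (avalanche delta n (add_letter u i (- 1)) <-> 1 <= tnth u i).
  move=> Au; have [u0 su] := (avalancheP _ _).1 Au.
  split=> [/(avalanche_letter_ge0 i)|ui].
    by rewrite tnth_add_letter eqxx; lia.
  apply/avalancheP; split=> [j|k].
    by rewrite tnth_add_letter; move: (u0 j); case: eqP => [->|_]; lia.
  by move: (su k); rewrite psum_add_letter; case: (i <= k)%N; lia.
suff cardP : avalanche delta n u ->
    [set v | covers (avalanche delta n) u v] #= `I_(dim_cliff delta n) <->
    (forall i : 'I_n, delta i.+1 != 0%N -> 1 <= tnth u i).
  by split=> -[Au] /(cardP Au).
move=> Au; rewrite (coversE (@avalanche_convex _ _) Au) card_image_ord_maxP.
- by split=> H i /H /(decP i Au).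
- exact: add_letter_inj.
- by move=> i /(decP i Au); have := avalanche_letter_le i Au; rewrite inE; lia.
Qed.

(** A position that can be incremented has [delta i.+1 != 0] since the
    incremented letter is positive and at most [delta i.+1]. *)
Lemma output_wingsP delta n (u : word n) :
  output_wings delta n u <->
  avalanche delta n u /\
  (forall i : 'I_n, delta i.+1 != 0%N -> avalanche delta n (add_letter u i 1)).
Proof.
suff cardP : avalanche delta n u ->
    [set v | covers (avalanche delta n) v u] #= `I_(dim_cliff delta n) <->
    (forall i : 'I_n, delta i.+1 != 0%N ->
       avalanche delta n (add_letter u i 1)).
  by split=> -[Au] /(cardP Au).
move=> Au.
rewrite (covered_byE (@avalanche_convex _ _) Au) card_image_ord_maxP //.
  exact: add_letter_inj.
move=> i /(avalanche_letter_le i); have := avalanche_letter_ge0 i Au.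
by rewrite tnth_add_letter eqxx inE; lia.
Qed.

(** * Wings for linear range maps *)

Lemma mmapS m i : mmap m i.+1 = (i * m)%N.
Proof. by rewrite /mmap subn1. Qed.

Definition starts0 (n : nat) : set (word n) :=
  [set u | forall i : 'I_n, i = 0%N :> nat -> tnth u i = 0].

Lemma avalanche_starts0 m n : avalanche (mmap m) n `<=` @starts0 n.
Proof.
move=> u Au i i0; apply/le_anti; rewrite (avalanche_letter_ge0 i Au) andbT.
by move: (avalanche_letter_le i Au); rewrite mmapS i0 mul0n.
Qed.

Lemma avalanche_mmapP m n (u : word n) :
  avalanche (mmap m) n u <->
  (forall i, 0 <= tnth u i) /\ (forall k : 'I_n, psum u k <= k%:Z * m%:Z).
Proof.
rewrite avalancheP; split=> -[u0 su]; split=> // k; have := su k;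
by rewrite mmapS PoszM.
Qed.

Lemma input_wings_mmapP m n (u : word n) : (0 < m)%N ->
  input_wings (mmap m) n u <->
  avalanche (mmap m) n u /\ (forall i : 'I_n, i != 0%N :> nat -> 1 <= tnth u i).
Proof.
move=> m0; rewrite input_wingsP; split=> -[Au H]; split=> // i;
by have := H i; rewrite mmapS muln_eq0 negb_or -(lt0n m) m0 andbT.
Qed.

(** Incrementing the letter at [i] raises the partial sums from [i] on, that at
    [i] included; so the strict bound at [k] comes from incrementing at [k]
    itself, and the strict bounds at all [k != 0] allow every increment. *)
Lemma output_wings_mmapP m n (u : word n) : (0 < m)%N ->
  output_wings (mmap m) n u <->
  avalanche (mmap m) n u /\
  (forall k : 'I_n, k != 0%N :> nat -> psum u k + 1 <= k%:Z * m%:Z).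
Proof.
move=> m0; rewrite output_wingsP.
have mmap0 (i : 'I_n) : (mmap m i.+1 != 0%N) = (i != 0%N :> nat).
  by rewrite mmapS muln_eq0 negb_or -(lt0n m) m0 andbT.
split=> -[Au H]; split=> //; [move=> k k0|move=> i].
  have := H k; rewrite mmap0 => /(_ k0) /avalanche_mmapP [_ /(_ k)].
  by rewrite psum_add_letter leqnn.
rewrite mmap0 => i0; have [u0 su] := (avalanche_mmapP _ _).1 Au.
apply/avalanche_mmapP; split=> [j|k].
  by rewrite tnth_add_letter; move: (u0 j); case: eqP; lia.
rewrite psum_add_letter; case: leqP => ik; last by rewrite addr0.
by apply: H; lia.
Qed.

(** * Translating all letters but the first *)

(** The maps [phi1] and [phi2] are, by conversion, the cases [c = 1] and
    [c = - 1]. *)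
Definition shift_tail (n : nat) (c : int) (u : word n) : word n :=
  [tuple (if i == 0%N :> nat then 0 else tnth u i + c) | i < n].

Lemma tnth_shift_tail n c (u : word n) i :
  tnth (shift_tail c u) i = if i == 0%N :> nat then 0 else tnth u i + c.
Proof. by rewrite tnth_mktuple. Qed.

Lemma shift_tail_starts0 n c (u : word n) : starts0 (shift_tail c u).
Proof. by move=> i i0; rewrite tnth_shift_tail i0. Qed.

Lemma shift_tailK n c (u : word n) :
  starts0 u -> shift_tail c (shift_tail (- c) u) = u.
Proof.
move=> u0; apply: eq_from_tnth => i; rewrite !tnth_shift_tail.
by case: eqP => [/u0->//|_]; rewrite subrK.
Qed.

Lemma le_shift_tail n c (u v : word n) : starts0 u -> starts0 v ->
  (u <= v)%O <-> (shift_tail c u <= shift_tail c v)%O.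
Proof.
move=> u0 v0; split=> /le_wordP uv; apply/le_wordP => i; move: (uv i);
  rewrite !tnth_shift_tail;
by case: eqP => [i0|_]; rewrite ?lerD2r // (u0 i) ?(v0 i).
Qed.

Lemma psum_shift_tail n c (u : word n) (k : 'I_n) : starts0 u ->
  psum (shift_tail c u) k = psum u k + c * k%:Z.
Proof.
move=> u0; rewrite /psum.
have shiftE (i : 'I_n) : (i <= k)%N ->
    tnth (shift_tail c u) i = tnth u i + (if i == 0%N :> nat then 0 else c).
  by move=> _; rewrite tnth_shift_tail; case: eqP => // /u0 ->.
rewrite (eq_bigr _ shiftE) big_split /=; congr (_ + _).
rewrite -(big_ord_widen n (fun i => if i == 0%N then 0 else c) (ltn_ord k)).
rewrite big_ord_recl /= add0r sumr_const card_ord.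
by rewrite -mulr_natr natz.
Qed.

Lemma shift_tail_embedding n c (A B : set (word n)) :
  A `<=` @starts0 n -> (forall u, A u -> B (shift_tail c u)) ->
  poset_embedding A B (shift_tail c).
Proof.
move=> A0 AB; split=> // u v /A0 u0 /A0 v0; exact: le_shift_tail.
Qed.

(** Stated as an equivalence on all words starting with 0, the hypothesis also
    gives surjectivity: the preimage of [v] is [shift_tail (- c) v]. *)
Lemma shift_tail_isomorphism n c (A B : set (word n)) :
  A `<=` @starts0 n -> B `<=` @starts0 n ->
  (forall u, starts0 u -> A u <-> B (shift_tail c u)) ->
  poset_isomorphism A B (shift_tail c).
Proof.
move=> A0 B0 AB; have [fAB mono] : poset_embedding A B (shift_tail c).
  by apply: shift_tail_embedding => // u Au; apply/AB => //; apply: A0.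
split=> //; split=> //.
  move=> u v; rewrite !inE => Au Av e; apply/le_anti/andP.
  by split; apply/mono => //; rewrite e.
move=> v Bv; exists (shift_tail (- c) v); last exact/shift_tailK/B0.
apply/AB; first exact: shift_tail_starts0.
by rewrite shift_tailK //; apply: B0.
Qed.

Theorem theorem2p1p5 (m n : nat) (hm : (1 <= m)%N) :
  [/\ poset_isomorphism (avalanche (mmap (m - 1)) n)
                        (input_wings (mmap m) n) (@phi1 n),
      poset_embedding (input_wings (mmap m) n)
                      (output_wings (mmap m) n) (@phi2 n)
    & poset_isomorphism (output_wings (mmap m) n)
                        (butterflies (mmap (m + 1)) n) (@phi1 n)].
Proof.
have input0 p : input_wings (mmap p) n `<=` @starts0 n.
  by move=> u [/avalanche_starts0].
have m1 : (0 < m + 1)%N by rewrite addn1.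
split.
- apply: (shift_tail_isomorphism (c := 1)) => //.
    exact: avalanche_starts0.
  move=> u u0; rewrite input_wings_mmapP // !avalanche_mmapP.
  split=> [[pos su]|[[pos su] pos1]].
    split; first split=> [i|k].
    + by rewrite tnth_shift_tail; move: (pos i); case: eqP; lia.
    + by rewrite psum_shift_tail //; move: (su k); nia.
    + by move=> i i0; rewrite tnth_shift_tail (negbTE i0); move: (pos i); lia.
  split=> [i|k]; last by move: (su k); rewrite psum_shift_tail //; nia.
  case: (eqVneq (i : nat) 0%N) => [/u0 ->//|i0].
  by move: (pos1 _ i0); rewrite tnth_shift_tail (negbTE i0); lia.
- apply: (shift_tail_embedding (c := - 1)) => // u Iu; have u0 := input0 _ _ Iu.
  move/(input_wings_mmapP _ hm): Iu => [/avalanche_mmapP [pos su] pos1].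
  apply/output_wings_mmapP => //; split; first apply/avalanche_mmapP.
    split=> [i|k]; last by rewrite psum_shift_tail //; move: (su k); nia.
    by rewrite tnth_shift_tail; case: (eqVneq (i : nat) 0%N) => // /pos1; lia.
  by move=> k k0; rewrite psum_shift_tail //; move: (su k) k0; nia.
- apply: (shift_tail_isomorphism (c := 1)).
  + by move=> u [/avalanche_starts0].
  + by move=> u [/input0].
  move=> u u0; rewrite /butterflies /setI /= input_wings_mmapP //.
  rewrite !output_wings_mmapP // !avalanche_mmapP.
  split=> [[[pos su] su1]|[[[_ _] pos1] [[_ su] su1]]].
    have shift_ge0 i : 0 <= tnth (shift_tail 1 u) i.
      by rewrite tnth_shift_tail; move: (pos i); case: eqP; lia.
    have shift_psum (k : 'I_n) :
        psum (shift_tail 1 u) k <= k%:Z * (m + 1)%N%:Z.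
      by rewrite psum_shift_tail //; move: (su k); nia.
    split; first split=> //.
      by move=> i i0; rewrite tnth_shift_tail (negbTE i0); move: (pos i); lia.
    by split=> // k k0; rewrite psum_shift_tail //; move: (su1 k k0); nia.
  split; first split=> [i|k].
  + case: (eqVneq (i : nat) 0%N) => [/u0 ->//|i0].
    by move: (pos1 _ i0); rewrite tnth_shift_tail (negbTE i0); lia.
  + by move: (su k); rewrite psum_shift_tail //; nia.
  + by move=> k k0; move: (su1 k k0); rewrite psum_shift_tail //; nia.
Qed.
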